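(* Let $I$ be a set, let $A$ be an $I$-dimensional cylindric Boolean algebra and let $X=\mathcal{F}_0(A)$ be its dual $I$-dimensional cylindric UV-space. Let $\phi\colon A\to\mathcal{REG}(X)$, $\phi(a)=\{x\in\mathfrak{F}(A):a\in x\}$. Then the completion $\langle\phi;\mathcal{REG}(X)\rangle$ is the canonical completion of $A$.
   Context: A quantifier on a Boolean algebra $A$ (complement written $a^{\perp}$) is a map $\exists\colon A\to A$ with $\exists(a\vee b)=\exists a\vee\exists b$, $\exists0=0$, $\exists\exists a=\exists a$, $a\le\exists a$, $\exists(\exists a)^{\perp}=(\exists a)^{\perp}$. An $I$-dimensional cylindric Boolean algebra is a Boolean algebra $A$ with unary operators $(\exists_i)_{i\in I}$ and constants $(\delta_{i,k})_{i,k\in I}$ such that for all $i,k,l\in I$ and $a\in A$: (1) $\exists_i$ is a quantifier; (2) $\exists_i\exists_ka=\exists_k\exists_ia$; (3) $\delta_{i,k}=\delta_{k,i}$, $\delta_{i,i}=1$; (4) if $k\neq i$ and $k\ne l$, then $\delta_{i,l}=\exists_k(\delta_{i,k}\wedge\delta_{k,l})$; (5) if $i\ne k$, then $\exists_i(\delta_{i,k}\wedge a)\wedge\exists_i(\delta_{i,k}\wedge a^{\perp})=0$. $\mathcal{F}_0(A)=\langle\mathfrak{F}(A);(S_i)_{i\in I},(\Delta_{i,k})_{i,k\in I},\tau(\beta)\rangle$, where $\mathfrak{F}(A)$ is the set of non-empty proper filters of $A$; $xS_iy$ iff $\{\exists_ia:a\in x\}=\{\exists_ia:a\in y\}$; $\Delta_{i,k}=\phi(\delta_{i,k})$;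 and $\tau(\beta)$ is the topology with basis $\{\phi(a):a\in A\}$. For a $T_0$-space $X$ with specialization order $\leqslant$ ($x\leqslant y$ iff every open set containing $x$ contains $y$; for $X=\mathcal{F}_0(A)$ this is inclusion of filters), let $\text{Int}_{\leqslant}(U)=\{x:y\in U\text{ for all }y\geqslant x\}$ and $\text{Cl}_{\leqslant}(U)=\{x:y\in U\text{ for some }y\geqslant x\}$. $\mathcal{REG}(X)$ is the set of regular open subsets of the upset topology of $(X,\leqslant)$, i.e. upsets $U$ with $\text{Int}_{\leqslant}(\text{Cl}_{\leqslant}(U))=U$, ordered by inclusion. For a bounded lattice $A$, a canonical completion of $A$ is a pair $\langle e;C\rangle$ with $C$ a complete lattice and $e\colon A\to C$ a (bounded lattice) embedding that is dense (every element of $C$ is both a meet of joins and a join of meets of elements of $e[A]$) and compact (for all $S,T\subseteq A$ there are finite $S'\subseteq S$, $T'\subseteq T$ such that $\bigwedge e[S]\le\bigvee e[T]$ implies $\bigwedge e[S']\le\bigvee e[T']$). It is unique up to isomorphism. *)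

(* Defs.v *)
From HB Require Import structures.
From mathcomp Require Import all_boot all_order.
From mathcomp Require Import all_classical.
From mathcomp Require Import topology.

Set Implicit Arguments.
Unset Strict Implicit.
Unset Printing Implicit Defensive.

Import Order.Theory.
Local Open Scope classical_set_scope.
Local Open Scope order_scope.

(* Boolean algebras are MathComp's ctbDistrLatticeType; \bot = \top is allowed. *)
Record quantifier {d} (A : ctbDistrLatticeType d) (ex : A -> A) : Prop := {
  quantifierU : forall a b, ex (a `|` b) = ex a `|` ex b;
  quantifier0 : ex \bot = \bot;
  quantifier_idem : forall a, ex (ex a) = ex a;
  quantifier_ge : forall a, a <= ex a;
  quantifierC : forall a, ex (~` ex a) = ~` ex a
}.

HB.mixin Record isCylindric (I : Type) d A of Order.CTBDistrLattice d A := {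
  cylex : I -> A -> A;
  cyldiag : I -> I -> A;
  cylex_quantifier : forall i, quantifier (cylex i);
  cylexC : forall i k a, cylex i (cylex k a) = cylex k (cylex i a);
  cyldiagC : forall i k, cyldiag i k = cyldiag k i;
  cyldiag_refl : forall i, cyldiag i i = \top;
  cyldiag_trans : forall i k l, k <> i -> k <> l ->
    cyldiag i l = cylex k (cyldiag i k `&` cyldiag k l);
  cyldiag_subst : forall i k a, i <> k ->
    cylex i (cyldiag i k `&` a) `&` cylex i (cyldiag i k `&` ~` a) = \bot
}.

#[short(type="cylindricBAType")]
HB.structure Definition CylindricBA (I : Type) d :=
  {A of isCylindric I d A & Order.CTBDistrLattice d A}.

Section ProperFilters.
Context {d : Order.disp_t} (A : ctbDistrLatticeType d).

Record lfilter := LFilter {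
  lfilter_set :> set A;
  lfilter_nonempty : lfilter_set !=set0;
  lfilter_proper : lfilter_set <> setT;
  lfilter_up : forall a b, a <= b -> lfilter_set a -> lfilter_set b;
  lfilter_meet : forall a b,
    lfilter_set a -> lfilter_set b -> lfilter_set (a `&` b)
}.

HB.instance Definition _ := gen_eqMixin lfilter.
HB.instance Definition _ := gen_choiceMixin lfilter.

Definition phi_set (a : A) : set lfilter := [set x : lfilter | lfilter_set x a].

Lemma lfilter_top (x : lfilter) : lfilter_set x \top.
Proof. by have [a xa] := lfilter_nonempty x; exact: lfilter_up (lex1 a) xa. Qed.

Lemma lfilter_bot (x : lfilter) : ~ lfilter_set x \bot.
Proof.
move=> x0; apply: (@lfilter_proper x); apply/seteqP; split=> // a _.
exact: lfilter_up (le0x a) x0.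
Qed.

Let phi_cover : \bigcup_(U in range phi_set) id U = setT.
Proof.
apply/seteqP; split=> // x _; exists (phi_set \top); last exact: lfilter_top.
by exists \top.
Qed.

Let phi_join (U V : set lfilter) (x : lfilter) :
  range phi_set U -> range phi_set V -> id U x -> id V x ->
  exists W, [/\ range phi_set W, id W x & id W `<=` (id U `&` id V)%classic].
Proof.
move=> [a _ <-] [b _ <-] xa xb; exists (phi_set (a `&` b)); split.
- by exists (a `&` b).
- exact: lfilter_meet xa xb.
- move=> y yab; split; [exact: lfilter_up (leIl _ _) yab|].
  exact: lfilter_up (leIr _ _) yab.
Qed.

HB.instance Definition _ :=
  isBaseTopological.Build lfilter phi_cover phi_join.

Lemma phi_set_open a : open (phi_set a).
Proof.
exists [set phi_set a]; first by move=> _ ->; exists a.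
by rewrite bigcup_set1.
Qed.

End ProperFilters.

(* The signature of I-dimensional cylindric UV-spaces. *)
Record cylindricFrame (I : Type) := CylindricFrame {
  frame_space :> topologicalType;
  frame_rel : I -> frame_space -> frame_space -> Prop;
  frame_diag : I -> I -> set frame_space
}.

Definition F0 (I : Type) d (A : cylindricBAType I d) : cylindricFrame I :=
  @CylindricFrame I (lfilter A)
    (fun i x y => cylex i @` lfilter_set x = cylex i @` lfilter_set y)
    (fun i k => phi_set (cyldiag i k)).

Section RegularOpens.
Context (X : topologicalType).
Implicit Types (x y : X) (U : set X).

Definition specialization x y := forall U, open U -> U x -> U y.

Definition upset U := forall x y, specialization x y -> U x -> U y.

Definition Int_le U : set X := [set x | forall y, specialization x y -> U y].
Definition Cl_le U : set X := [set x | exists2 y, specialization x y & U y].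

Definition regular_open_upset U := upset U /\ Int_le (Cl_le U) = U.

Record REG := MkREG {
  REG_set :> set X;
  REG_setP : `[< regular_open_upset REG_set >]
}.

HB.instance Definition _ := [isSub for REG_set].
HB.instance Definition _ := [Choice of REG by <:].
HB.instance Definition _ := [SubChoice_isSubPOrder of REG by <: with set_display].

End RegularOpens.

Section Phi.
Context {I : Type} {d : Order.disp_t} {A : cylindricBAType I d}.

Lemma specializationE (x y : F0 A) :
  specialization x y <-> lfilter_set x `<=` lfilter_set y.
Proof.
split=> [xy a xa | xy U [D sD <-] [V DV Vx]].
  exact: (xy (phi_set a) (phi_set_open a) xa).
exists V => //; have [a _ aV] := sD V DV; rewrite -aV.
by apply: xy; move: Vx; rewrite -aV.
Qed.

(* If a is not in x, the filter generated by x and ~` a is proper. *)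
Lemma lfilter_extend (x : F0 A) a : ~ lfilter_set x a ->
  exists2 y : F0 A, specialization x y & lfilter_set y (~` a).
Proof.
move=> xNa; pose y := [set b | exists2 c, lfilter_set x c & c `&` ~` a <= b].
have y0 : y !=set0 by exists \top; exists \top; [exact: lfilter_top|exact: lex1].
have yT : y <> setT.
  move=> yT; have : y \bot by rewrite yT.
  move=> [c xc]; rewrite lex0 => /eqP ca0; apply: xNa.
  by apply: lfilter_up xc; rewrite -(complK a) -disj_leC ca0.
have yU b c : b <= c -> y b -> y c.
  by move=> bc [e xe eb]; exists e => //; exact: le_trans bc.
have yI b c : y b -> y c -> y (b `&` c).
  move=> [e xe eb] [f xf fc]; exists (e `&` f); first exact: lfilter_meet.
  rewrite lexI; apply/andP; split.
    by apply: le_trans eb; exact: leI2 (leIl _ _) (lexx _).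
  by apply: le_trans fc; exact: leI2 (leIr _ _) (lexx _).
exists (LFilter y0 yT yU yI).
  by apply/specializationE => b xb; exists b => //; exact: leIl.
by exists \top; [exact: lfilter_top|exact: leIr].
Qed.

Lemma phi_regular a : `[< regular_open_upset (phi_set a : set (F0 A)) >].
Proof.
apply/asboolP; split=> [x y xy|].
  exact: (xy (phi_set a) (phi_set_open a)).
apply/seteqP; split=> [x IClx|x xa y xy]; last first.
  by exists y; [move=> ? | exact: (xy (phi_set a) (phi_set_open a) xa)].
apply: contrapT => /lfilter_extend[y xy yNa].
have [z /specializationE yz za] := IClx y xy.
apply: (@lfilter_bot _ _ z); rewrite -(meetxC a).
exact: lfilter_meet za (yz _ yNa).
Qed.

Definition phi (a : A) : REG (F0 A) := MkREG (phi_regular a).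

End Phi.

Section CanonicalCompletion.
Context {d d' : Order.disp_t} {A : tbLatticeType d} {C : porderType d'}.
Implicit Types (e : A -> C) (S T : set A).

Definition complete_lattice (P : porderType d') :=
  forall D : set P, infimums D !=set0 /\ supremums D !=set0.

Record bounded_lattice_embedding e : Prop := {
  embedding_inj : injective e;
  embeddingI : forall a b, infimums [set e a; e b] (e (a `&` b));
  embeddingU : forall a b, supremums [set e a; e b] (e (a `|` b));
  embedding0 : lbound setT (e \bot);
  embedding1 : ubound setT (e \top)
}.

Definition join_of_image e : set C :=
  [set c | exists S, supremums (e @` S) c].
Definition meet_of_image e : set C :=
  [set c | exists S, infimums (e @` S) c].

Definition dense_embedding e := forall c : C,
  (exists2 D, D `<=` join_of_image e & infimums D c) /\
  (exists2 D, D `<=` meet_of_image e & supremums D c).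

(* In a complete lattice: the meet of e[S] is below the join of e[T]. *)
Definition meet_le_join e S T := forall m j : C,
  infimums (e @` S) m -> supremums (e @` T) j -> m <= j.

Definition compact_embedding e := forall S T, exists S' T' : set A,
  [/\ finite_set S' /\ S' `<=` S, finite_set T' /\ T' `<=` T
    & meet_le_join e S T -> meet_le_join e S' T'].

Definition canonical_completion e :=
  [/\ complete_lattice C, bounded_lattice_embedding e,
      dense_embedding e & compact_embedding e].

End CanonicalCompletion.

(* Main.v *)
Require Import Defs.
From mathcomp Require Import all_boot all_order.
From mathcomp Require Import all_classical.
From mathcomp Require Import topology.

(** Filters ordered by inclusion behave like forcing conditions: a regular open
upset [U] is one such that every point outside [U] has an extension no further
extension of which lies in [U] ([regular_open_sep]).

Each filter [y] yields two elements of the completion: the cone of all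
filters extending [y], and the set of all filters incompatible with [y] (its
pseudocomplement). The cone is the meet of the [phi a] for [a] in [y]
([infimums_cone]). The incompatible filters are the join of the [phi a] for
[~` a] in [y] ([supremums_incompatible]), because two filters without a common
proper extension contain complementary elements ([lfilter_join]). Density
follows: a regular open set is the union of the cones inside it, and, by
[regular_open_sep], the intersection of the sets of incompatible filters which
contain it.

For compactness, suppose that the meet of [phi @` S] is below the join of
[phi @` T]. A proper filter containing [S] and the complements of the
elements of [T] would lie in the meet, hence in the join; but the
filters incompatible with it form an upper bound of [phi @` T] which it does not
belong to. So no such filter exists, which means that a finite meet from [S] is
below a finite join from [T]; and [phi] preserves those. *)

Set Implicit Arguments.
Unset Strict Implicit.
Unset Printing Implicit Defensive.

Import Order.Theory.
Local Open Scope classical_set_scope.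
Local Open Scope order_scope.

(** * Regular open upsets of a topological space *)

Section RegularOpenUpsets.
Context {X : topologicalType}.
Implicit Types (x y z : X) (U : set X) (V W : REG X).

Lemma specialization_refl x : specialization x x.
Proof. by []. Qed.

Lemma specialization_trans y x z :
  specialization x y -> specialization y z -> specialization x z.
Proof. by move=> xy yz U oU /(xy U oU); exact: yz. Qed.

Lemma REG_regular V : regular_open_upset V.
Proof. exact/asboolP/REG_setP. Qed.

Lemma REG_up V x y : specialization x y -> REG_set V x -> REG_set V y.
Proof. by case: (REG_regular V) => up _; exact: up. Qed.

Lemma REG_leP V W : reflect (V `<=` W) (V <= W).
Proof. by apply: (iffP idP); rewrite -Order.le_val subsetEset. Qed.

Lemma regular_open_sep V x : ~ REG_set V x ->
  exists2 y, specialization x y & forall z, specialization y z -> ~ REG_set V z.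
Proof.
have [_ VE] := REG_regular V; rewrite -{1}VE => xNV.
apply: contrapT => noy; apply: xNV => y xy; apply: contrapT => yNV.
by apply: noy; exists y => // z yz Vz; apply: yNV; exists z.
Qed.

(** Separation gives [Int_le (Cl_le U) `<=` U]; the converse inclusion holds for
every upset. *)
Lemma regular_open_upsetP U : upset U ->
  (forall x, ~ U x ->
    exists2 y, specialization x y & forall z, specialization y z -> ~ U z) ->
  regular_open_upset U.
Proof.
move=> upU sepU; split=> //; apply/seteqP; split=> [x IClx|x Ux y xy].
  apply: contrapT => /sepU[y xy yNU].
  by have [z yz Uz] := IClx y xy; exact: yNU yz Uz.
by exists y; [exact: specialization_refl|exact: upU xy Ux].
Qed.

Lemma regular_bigcap (D : set (REG X)) :
  regular_open_upset [set x | forall V, D V -> REG_set V x].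
Proof.
apply: regular_open_upsetP => [x y xy Dx V DV|x].
  exact: REG_up xy (Dx V DV).
move=> /existsNP[V] /not_implyP[DV /regular_open_sep[y xy yNV]].
by exists y => // z yz Dz; exact: yNV yz (Dz V DV).
Qed.

Definition REG_inf (D : set (REG X)) : REG X := MkREG (asboolT (regular_bigcap D)).

Lemma infimums_REG_inf (D : set (REG X)) : infimums D (REG_inf D).
Proof.
split=> [V DV|W lbW]; apply/REG_leP => x; first exact.
by move=> Wx V /lbW /REG_leP; exact.
Qed.

(** A join is the meet of the upper bounds, so meets suffice. *)
Lemma REG_complete : complete_lattice (REG X).
Proof.
move=> D; split; first by exists (REG_inf D); exact: infimums_REG_inf.
exists (REG_inf (ubound D)); have [lb glb] := infimums_REG_inf (ubound D).
by split=> // V DV; apply: glb => W; exact.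
Qed.

Lemma regular_incompatible y :
  regular_open_upset [set x | forall z, specialization x z -> ~ specialization y z].
Proof.
apply: regular_open_upsetP => [x x' xx' xy z x'z|x].
  by apply: xy; exact: specialization_trans x'z.
move=> /existsNP[z] /not_implyP[xz /contrapT yz]; exists z => // w zw zwy.
by apply: (zwy w (@specialization_refl w)); exact: specialization_trans zw.
Qed.

(** The pseudocomplement of the principal upset of [y]. *)
Definition incompatible y : REG X := MkREG (asboolT (regular_incompatible y)).

Lemma incompatible_self y : ~ REG_set (incompatible y) y.
Proof. by move=> /(_ y (@specialization_refl y)); apply. Qed.

(** If [V] omits [x], then it omits every extension of some [y] above [x];
hence [V] is below [incompatible y], to which [x] does not belong. *)
Lemma infimums_incompatible V :
  infimums [set W | V <= W /\ exists y, W = incompatible y] V.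
Proof.
split=> [W []//|W lbW]; apply/REG_leP => x Wx.
apply: contrapT => /regular_open_sep[y xy yNV].
have /lbW/REG_leP/(_ x Wx) : [set W | V <= W /\ exists y, W = incompatible y]
    (incompatible y).
  split; last by exists y.
  apply/REG_leP => v Vv z vz yz; exact: yNV yz (REG_up vz Vv).
by move=> /(_ y xy); apply.
Qed.

End RegularOpenUpsets.

(** * Joins of filters *)

Section FilterJoin.
Context {d : Order.disp_t} {A : ctbDistrLatticeType d}.
Implicit Types (P Q : set A).

(** Elements [a] of [P] and [b] of [Q] with [a <= ~` b] are exactly what makes
the filter generated by the union of [P] and [Q] improper: closure of each set
under meets reduces a finite meet from the union to one of the form
[a `&` b]. *)
Lemma lfilter_join P Q : P !=set0 -> Q !=set0 ->
  (forall a b, P a -> P b -> P (a `&` b)) ->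
  (forall a b, Q a -> Q b -> Q (a `&` b)) ->
  (exists a b, [/\ P a, Q b & a <= ~` b]) \/
  (exists z : lfilter A, P `<=` lfilter_set z /\ Q `<=` lfilter_set z).
Proof.
move=> [p Pp] [q Qq] PI QI.
pose z := [set c | exists a b, [/\ P a, Q b & a `&` b <= c]].
have [|NPQ] := pselect (exists a b, [/\ P a, Q b & a <= ~` b]); first by left.
have z0 : z !=set0 by exists (p `&` q); exists p, q.
have zT : z <> setT.
  move=> zT; have : z \bot by rewrite zT.
  move=> [a [b [Pa Qb]]]; rewrite lex0 disj_leC => ab.
  by apply: NPQ; exists a, b.
have zU a b : a <= b -> z a -> z b.
  by move=> ab [e [f [Pe Qf efa]]]; exists e, f; split=> //; exact: le_trans ab.
have zI a b : z a -> z b -> z (a `&` b).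
  move=> [e [f [Pe Qf efa]]] [e' [f' [Pe' Qf' efb]]].
  exists (e `&` e'), (f `&` f'); split; [exact: PI|exact: QI|].
  by rewrite meetACA; exact: leI2.
right; exists (LFilter z0 zT zU zI); split=> a ?.
  by exists a, q; split=> //; exact: leIl.
by exists p, a; split=> //; exact: leIr.
Qed.

End FilterJoin.

(** * Finite meets and joins under a lattice embedding *)

Section FiniteMeetsJoins.
Context {d d' : Order.disp_t} {A : tbLatticeType d} {C : porderType d'}.
Context (e : A -> C) (eE : bounded_lattice_embedding e).

Lemma embedding_le a b : a <= b -> e a <= e b.
Proof.
move=> /meet_idPl <-; have [lb _] := embeddingI eE a b.
by apply: lb; right.
Qed.

Lemma le_embedding_meet (s : seq A) m :
  lbound (e @` [set` s]) m -> m <= e (\meet_(a <- s) a).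
Proof.
elim: s => [|a s IHs] lbm; first by rewrite big_nil; exact: (embedding1 eE).
rewrite big_cons; have [_] := embeddingI eE a (\meet_(b <- s) b); apply.
move=> _ [->|->]; first by apply: lbm; exists a => //=; exact: mem_head.
apply: IHs => _ [b /= bs <-]; apply: lbm; exists b => //=.
by rewrite inE bs orbT.
Qed.

Lemma embedding_join_le (s : seq A) j :
  ubound (e @` [set` s]) j -> e (\join_(a <- s) a) <= j.
Proof.
elim: s => [|a s IHs] ubj; first by rewrite big_nil; exact: (embedding0 eE).
rewrite big_cons; have [_] := embeddingU eE a (\join_(b <- s) b); apply.
move=> _ [->|->]; first by apply: ubj; exists a => //=; exact: mem_head.
apply: IHs => _ [b /= bs <-]; apply: ubj; exists b => //=.
by rewrite inE bs orbT.
Qed.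

End FiniteMeetsJoins.

(** * The canonical completion *)

Section CanonicalCompletionPhi.
Context {I : Type} {d : Order.disp_t} {A : cylindricBAType I d}.
Implicit Types (x y z : F0 A) (V : REG (F0 A)) (a b : A).

(** Witnessed by the principal filter of [a `&` ~` b] when [a] is not below
[b]. *)
Lemma phi_inj : injective (phi : A -> REG (F0 A)).
Proof.
have phi_le a b : phi a = phi b :> REG (F0 A) -> a <= b.
  move=> ab; apply: contrapT => aNb.
  have single (c : A) : [set c] !=set0 by exists c.
  have singleI (c : A) e f : [set c] e -> [set c] f -> [set c] (e `&` f).
    by move=> -> ->; rewrite meetxx.
  have [[_ [_ [-> -> //]]]|] :=
    lfilter_join (single a) (single (~` b)) (@singleI a) (@singleI (~` b)).
    by rewrite complK.
  move=> [z [za zNb]]; have : REG_set (phi b : REG (F0 A)) z by rewrite -ab; exact: za.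
  move=> zb; apply: (@lfilter_bot _ _ z); rewrite -(meetxC b).
  exact: lfilter_meet zb (zNb _ erefl).
by move=> a b ab; apply/le_anti/andP; split; exact: phi_le.
Qed.

Lemma phi_embedding : bounded_lattice_embedding (phi : A -> REG (F0 A)).
Proof.
split=> [|a b|a b|V _|V _].
- exact: phi_inj.
- split=> [_ [|] ->|W lbW]; apply/REG_leP => x.
  + by apply: lfilter_up; exact: leIl.
  + by apply: lfilter_up; exact: leIr.
  + move=> Wx; apply: lfilter_meet.
      by have /REG_leP/(_ x Wx) := lbW (phi a) (or_introl erefl).
    by have /REG_leP/(_ x Wx) := lbW (phi b) (or_intror erefl).
- split=> [_ [|] ->|W ubW]; apply/REG_leP => x.
  + by apply: lfilter_up; exact: leUl.
  + by apply: lfilter_up; exact: leUr.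
  move=> xab; apply: contrapT => /regular_open_sep[y xy yNW].
  (* An extension of x outside W for good omits a; forcing ~` a then forces b. *)
  have yNa : ~ lfilter_set y a.
    move=> ya; apply: (yNW y (@specialization_refl _ y)).
    by have /REG_leP := ubW (phi a) (or_introl erefl); apply.
  have [z yz zNa] := lfilter_extend yNa; apply: (yNW z yz).
  have /REG_leP := ubW (phi b) (or_intror erefl); apply.
  have zab : lfilter_set z (a `|` b).
    by have /specializationE := specialization_trans xy yz; apply.
  apply: (@lfilter_up _ _ z (~` a `&` (a `|` b))); last exact: lfilter_meet.
  by rewrite meetUr meetCx join0x leIr.
- by apply/REG_leP => x /lfilter_bot.
- by apply/REG_leP => x _; exact: lfilter_top.
Qed.

(** The principal upset of [y], see [coneP]; taken as a meet it is regular open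
by construction. *)
Definition cone y : REG (F0 A) := REG_inf (phi @` lfilter_set y).

Lemma coneP x y : REG_set (cone y) x <-> specialization y x.
Proof.
rewrite specializationE; split=> [yx a ya|yx _ [a ya <-]]; last exact: yx.
by apply: (yx (phi a)); exists a.
Qed.

Lemma infimums_cone y : infimums (phi @` lfilter_set y) (cone y).
Proof. exact: infimums_REG_inf. Qed.

(** An upset contains the cone of each of its points, so it is the union of the
cones inside it. *)
Lemma supremums_cone V : supremums [set W | W <= V /\ exists y, W = cone y] V.
Proof.
split=> [W []//|W ubW]; apply/REG_leP => x Vx.
have /ubW/REG_leP : [set W | W <= V /\ exists y, W = cone y] (cone x).
  split; last by exists x.
  by apply/REG_leP => y /coneP xy; exact: REG_up xy Vx.
by apply; apply/coneP; exact: specialization_refl.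
Qed.

Lemma phi_le_incompatible y a : lfilter_set y (~` a) -> phi a <= incompatible y.
Proof.
move=> yNa; apply/REG_leP => x xa z /specializationE xz /specializationE yz.
apply: (@lfilter_bot _ _ z); rewrite -(meetxC a).
by apply: lfilter_meet; [exact: xz|exact: yz].
Qed.

(** The join is even the union: a filter incompatible with [y] contains the
complement of an element of [y]. *)
Lemma supremums_incompatible y :
  supremums (phi @` [set a | lfilter_set y (~` a)]) (incompatible y).
Proof.
split=> [_ [a yNa <-]|W ubW]; first exact: phi_le_incompatible.
apply/REG_leP => x xy.
have [] := lfilter_join (lfilter_nonempty x) (lfilter_nonempty y)
  (@lfilter_meet _ _ x) (@lfilter_meet _ _ y); last first.
  by move=> [z [/specializationE xz /specializationE yz]]; case: (xy z xz).
move=> [a [b [xa yb aNb]]].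
have /ubW/REG_leP : (phi @` [set a | lfilter_set y (~` a)]) (phi (~` b)).
  by exists (~` b) => //=; rewrite complK.
by apply; exact: lfilter_up aNb xa.
Qed.

Lemma phi_dense : dense_embedding (phi : A -> REG (F0 A)).
Proof.
move=> V; split.
- exists [set W | V <= W /\ exists y, W = incompatible y].
    move=> _ [_ [y ->]]; exists [set a | lfilter_set y (~` a)].
    exact: supremums_incompatible.
  exact: infimums_incompatible.
- exists [set W | W <= V /\ exists y, W = cone y].
    by move=> _ [_ [y ->]]; exists (lfilter_set y); exact: infimums_cone.
  exact: supremums_cone.
Qed.

(** The sets [P] of finite meets from [S] and [Q] of complements of finite joins
from [T] are closed under meets, so [lfilter_join] applies to them. Its first
alternative is the finite inequality sought; its second is a filter which
belongs to the meet of [phi @` S] but not to the join of [phi @` T]. *)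
Lemma phi_compact : compact_embedding (phi : A -> REG (F0 A)).
Proof.
move=> S T.
have [ST|NST] := pselect (meet_le_join (phi : A -> REG (F0 A)) S T); last first.
  by exists set0, set0; split=> //; split.
pose P := [set a | exists2 s : seq A, [set` s] `<=` S & a = \meet_(b <- s) b].
pose Q := [set a | exists2 t : seq A, [set` t] `<=` T & a = ~` \join_(b <- t) b].
have sub_nil (U : set A) : [set` [::]] `<=` U by [].
have sub_cat (U : set A) (s t : seq A) :
    [set` s] `<=` U -> [set` t] `<=` U -> [set` s ++ t] `<=` U.
  by move=> sU tU a /=; rewrite mem_cat => /orP[/sU|/tU].
have P0 : P !=set0 by exists (\meet_(b <- [::]) b); exists [::].
have Q0 : Q !=set0 by exists (~` \join_(b <- [::]) b); exists [::].
have PI a b : P a -> P b -> P (a `&` b).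
  by move=> [s sS ->] [t tS ->]; exists (s ++ t); [exact: sub_cat|rewrite big_cat].
have QI a b : Q a -> Q b -> Q (a `&` b).
  move=> [s sS ->] [t tS ->]; exists (s ++ t); first exact: sub_cat.
  by rewrite big_cat complU.
have [[_ [_ [[s sS ->] [t tT ->]]]]|[z [Pz Qz]]] := lfilter_join P0 Q0 PI QI.
  rewrite complK => st; exists [set` s], [set` t]; split.
  - by split; [exact: finite_seq|].
  - by split; [exact: finite_seq|].
  - move=> _ m j [lbm _] [ubj _].
    apply: le_trans (le_embedding_meet phi_embedding lbm) _.
    apply: le_trans (embedding_le phi_embedding st) _.
    exact: (embedding_join_le phi_embedding ubj).
exfalso; have [_ [j supj]] := @REG_complete (F0 A) (phi @` T).
have /REG_leP := ST _ _ (infimums_REG_inf (phi @` S)) supj.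
move=> /(_ z) zj; apply: (@incompatible_self _ (z : F0 A)).
have sing (U : set A) c : U c -> [set` [:: c]] `<=` U.
  by move=> Uc b /=; rewrite inE => /eqP ->.
have /REG_leP : j <= incompatible (z : F0 A).
  case: supj => _; apply=> _ [c Tc <-]; apply: phi_le_incompatible.
  by apply: Qz; exists [:: c]; [exact: sing|rewrite big_seq1].
apply; apply: zj => _ [c Sc <-].
by apply: Pz; exists [:: c]; [exact: sing|rewrite big_seq1].
Qed.

End CanonicalCompletionPhi.

Theorem theorem7p8 (I : Type) (d : Order.disp_t) (A : cylindricBAType I d) :
  canonical_completion (phi : A -> REG (F0 A)).
Proof.
split; [exact: REG_complete|exact: phi_embedding|exact: phi_dense|].
exact: phi_compact.
Qed.
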